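(* There exist constants $c_0>0$ and $w_0>0$ such that the following holds. Let $\mathbf w=\mathbf w^{(n)}=(w_v)_{v\in[n]}$ be a sequence (in $n$) of vectors of positive weights with $\max_v w_v^2=o(\bar w n)$ as $n\to\infty$, and suppose that $$w_0\le w_{\min}\le w_{\max}\le n^{0.99}.$$ Then, with probability tending to $1$ as $n\to\infty$, $$q^*\bigl(G(n,\mathbf w)\bigr)\ \le\ c_0\,w_{\min}^{-1/2}.$$
   Context: Here $\bar w=\frac1n\sum_v w_v$, $w_{\min}=\min_v w_v$ and $w_{\max}=\max_v w_v$. The Chung–Lu random graph $G(n,\mathbf w)$ is the random simple graph on $[n]=\{1,\dots,n\}$ in which each pair $uv$ with $u\ne v$ is an edge independently with probability $p_{uv}=\frac{w_uw_v}{\bar w n}$ (a number in $[0,1]$ for large $n$ by the assumption on $\max_v w_v^2$). Modularity: for a graph $G$ with $m\ge 1$ edges and a partition $\mathcal A$ of $V(G)$, $q_{\mathcal A}(G)=\sum_{A\in\mathcal A}\left(\frac{e(A)}{m}-\left(\frac{\mathrm{vol}(A)}{2m}\right)^2\right)$, where $e(A)$ is the number of edges inside $A$ and $\mathrm{vol}(A)$ is the sum of the degrees of the vertices in $A$; $q^*(G)=\max_{\mathcal A}q_{\mathcal A}(G)$ over all partitions of $V(G)$. *)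

(* Defs.v *)
From mathcomp Require Import all_boot all_order all_algebra.
From mathcomp Require Import reals.
Import Order.TTheory GRing.Theory Num.Theory.

Set Implicit Arguments.
Unset Strict Implicit.
Unset Printing Implicit Defensive.

Local Open Scope ring_scope.

Definition vpairs (T : finType) : {set {set T}} := [set e : {set T} | #|e| == 2%N].

(* A simple graph on the vertex set T, given by its edge set: each edge is a
   two-element subset of T. *)
Definition sgraph (T : finType) := {E : {set {set T}} | E \subset vpairs T}.

Section Modularity.
Variables (R : realType) (T : finType).
Implicit Types (G : sgraph T) (A : {set T}) (P : {set {set T}}).

Definition edges G : {set {set T}} := val G.

Definition nedges G : nat := #|edges G|.

Definition nedges_in G A : nat := #|[set e in edges G | e \subset A]|.

Definition degree G (v : T) : nat := #|[set e in edges G | v \in e]|.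

Definition vol G A : nat := (\sum_(v in A) degree G v)%N.

(* Since x / 0 = 0, a graph without edges has modularity 0. *)
Definition modularity G P : R :=
  \sum_(A in P) ((nedges_in G A)%:R / (nedges G)%:R
                 - ((vol G A)%:R / (2 * nedges G)%N%:R) ^+ 2).

(* The default value of the maximum is the score of the one-block partition,
   so for nonempty T this is exactly a maximum over the partitions of T. *)
Definition max_modularity G : R :=
  \big[Num.max/modularity G [set [set: T]]]_(P : {set {set T}} | partition P [set: T])
     modularity G P.

End Modularity.

Section ChungLu.
Variables (R : realType) (n : nat).
Implicit Types (w : 'I_n -> R) (G : sgraph 'I_n).

Definition wmean w : R := n%:R^-1 * \sum_v w v.

(* The default values below are irrelevant when n > 0 and w is positive. *)
Definition wmax w : R := \big[Num.max/0]_v w v.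

Definition wmin w : R := \big[Num.min/wmax w]_v w v.

(* For e = {u, v} with u != v this is w_u w_v / (wmean n). *)
Definition edge_prob w (e : {set 'I_n}) : R :=
  (\prod_(v in e) w v) / (wmean w * n%:R).

(* Law of the random graph in which the pairs are independently edges with
   probabilities edge_prob w e; a genuine probability mass function as soon as
   all of these lie in [0, 1]. *)
Definition chung_lu w G : R :=
  \prod_(e in vpairs 'I_n)
     (if e \in edges G then edge_prob w e else 1 - edge_prob w e).

Definition chung_lu_prob w (Q : pred (sgraph 'I_n)) : R :=
  \sum_(G | Q G) chung_lu w G.

End ChungLu.

Arguments modularity R {T} G P.
Arguments max_modularity R {T} G.

(* Main.v *)
(** Colour the blocks of a partition independently by uniform signs and let s_v
  be the sign of the block of v. With y = sum_{uv in E} s_u s_v and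
  d = sum_v deg(v) s_v, the average of y/m - (d/2m)^2 is the modularity of the
  partition, so it suffices to bound y/m - (d/2m)^2 for all 2^n sign vectors s.
  Put W = sum_v w_v, S = sum_v s_v w_v and r = w_min^(-1/2). Up to errors
  O(r W^2) and O(r W), coming from sum_v w_v^2 <= r W^2, the means of W y, d and 2m
  are at most S^2/2, equal to S, and equal to W. By Chernoff's bound each of y
  and d exceeds its mean by 6 r W with probability at most
  exp(-2 r^2 W) <= exp(-2n) <= 4^(-n), because W >= n w_min. A union bound over
  the sign vectors thus yields y/m - (d/2m)^2 = O(r) for all of them at once. *)
Require Import Defs.
From mathcomp Require Import all_boot all_order all_algebra.
From mathcomp Require Import all_classical all_reals all_analysis.
From mathcomp Require Import ring lra.
Import Order.TTheory GRing.Theory Num.Theory.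
Import numFieldNormedType.Exports.

(** * Sums over unordered pairs and over graphs *)

Section PairSums.
Local Open Scope ring_scope.
Variable T : finType.

Lemma edges_vpairs (G : sgraph T) : edges G \subset vpairs T.
Proof. exact: (valP G). Qed.

(** Each set {x, y} of size two arises from exactly the two ordered pairs (x, y) and (y, x). *)
Lemma sum_vpairs2 (V : nmodType) (F : {set T} -> V) :
  \sum_u \sum_(v | v != u) F [set u; v] = (\sum_(e in vpairs T) F e) *+ 2.
Proof.
rewrite pair_big_dep /=.
rewrite (partition_big (fun p : T * T => [set p.1; p.2]) (mem (vpairs T))) /=;
  last by move=> [u v] /= uv; rewrite inE cards2 (eq_sym u) uv.
rewrite -sumrMnl; apply: eq_bigr => e; rewrite inE => /cards2P[x [y [xy ->]]].
rewrite (bigD1 (x, y)) /=; last by rewrite eqxx (eq_sym y) xy.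
rewrite (bigD1 (y, x)) /=; last first.
  by rewrite xy finset.setUC eqxx /= xpair_eqE negb_and (eq_sym y) xy.
rewrite [X in _ + (_ + X)]big1 ?addr0 ?mulr2n; last first.
  move=> [u v] /= /andP[/andP[/andP[uv /eqP E]]]; rewrite !xpair_eqE => n1 n2.
  have : u \in [set x; y] by rewrite -E !inE eqxx.
  have : v \in [set x; y] by rewrite -E !inE eqxx orbT.
  rewrite !inE => /orP[]/eqP hv /orP[]/eqP hu; subst u v;
  by rewrite ?eqxx in uv n1 n2.
by rewrite [in X in _ + X]finset.setUC.
Qed.

(** Expanding the product on the right selects a set of pairs, that is, a graph. This yields both
    the total mass and the exponential moments of the random graph. *)
Lemma sum_sgraph_prod (R : comPzRingType) (F H : {set T} -> R) :
  \sum_(G : sgraph T) \prod_(e in vpairs T) (if e \in edges G then F e else H e)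
  = \prod_(e in vpairs T) (F e + H e).
Proof.
rewrite [RHS]big_mkcond /=.
(* Outside [vpairs T] a factor 1 is written as 0 + 1, so that the product runs over all sets and
   every selection that leaves [vpairs T] contributes 0. *)
rewrite (eq_bigr (fun e => (if e \in vpairs T then F e else 0)
                         + (if e \in vpairs T then H e else 1))); last first.
  by move=> e _; case: ifP => // _; rewrite add0r.
rewrite (bigA_distr 1) /=.
rewrite (bigID (fun J : {set {set T}} => J \subset vpairs T)) /=.
rewrite [X in _ = _ + X]big1 ?addr0; last first.
  move=> J /subsetPn[e eJ eV]; rewrite (bigD1 e) //= eJ (negbTE eV) mul0r //.
rewrite (big_sub (fun J : {set {set T}} => J \subset vpairs T)).
apply: eq_bigr => G _; rewrite big_mkcond /=; apply: eq_bigr => e _.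
case: ifP => eV; rewrite /edges //=.
by case: ifP => // eG; have := fintype.subsetP (edges_vpairs G) _ eG; rewrite eV.
Qed.

End PairSums.

(** * Random signs on the blocks of a partition *)

Section Signs.
Local Open Scope ring_scope.
Variables (R : realType) (T : finType).
Implicit Types (G : sgraph T) (s : T -> R).

Lemma prod_set2 (x y : T) s : x != y -> \prod_(v in [set x; y]) s v = s x * s y.
Proof. by move=> xy; rewrite big_setU1 ?inE //= big_set1. Qed.

Lemma sum_set2 (x y : T) s : x != y -> \sum_(v in [set x; y]) s v = s x + s y.
Proof. by move=> xy; rewrite big_setU1 ?inE //= big_set1. Qed.

(** For signs [s], the number of edges whose ends agree minus the number whose ends differ. *)
Definition pair_sum G s : R := \sum_(e in edges G) \prod_(v in e) s v.

Definition degree_sum G s : R := \sum_v (degree G v)%:R * s v.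

(** Double counting of incidences; a sum over edges is the form that Chernoff's bound handles. *)
Lemma degree_sumE G s : degree_sum G s = \sum_(e in edges G) \sum_(v in e) s v.
Proof.
transitivity (\sum_v \sum_(e in edges G) if v \in e then s v else 0).
  apply: eq_bigr => v _; rewrite -big_mkcondr /= sumr_const mulr_natl.
  by congr (_ *+ _); apply: eq_card => e; rewrite inE.
by rewrite exchange_big; apply: eq_bigr => e _; rewrite [RHS]big_mkcond.
Qed.

(** For [a != b], flipping the sign at [a] is an involution that negates every summand. *)
Lemma sum_signs (I : finType) (a b : I) :
  \sum_(f : {ffun I -> bool}) (-1) ^+ f a * (-1) ^+ f b
  = #|{ffun I -> bool}|%:R * (a == b)%:R :> R.
Proof.
have [->|ab] := eqVneq a b.
  rewrite mulr1 (eq_bigr (fun=> 1)) ?sumr_const // => f _.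
  by rewrite -signr_addb addbb.
rewrite mulr0; set S := LHS.
pose h (f : {ffun I -> bool}) := [ffun x => f x (+) (x == a)].
have hK : involutive h by move=> f; apply/ffunP => x; rewrite !ffunE addbK.
have : S = - S.
  rewrite {1}/S (reindex_inj (inv_inj hK)) -sumrN; apply: eq_bigr => f _.
  by rewrite !ffunE eqxx eq_sym (negbTE ab) addbF addbT signrN mulNr.
lra.
Qed.

Variables (P : {set {set T}}) (G : sgraph T).
Hypothesis partP : finset.partition P [set: T].

Lemma pblock_partition (v : T) (A : {set T}) :
  A \in P -> (v \in A) = (finset.pblock P v == A).
Proof.
case/and3P: partP => /eqP cov triv _ AP.
apply/idP/eqP => [vA|<-]; first exact: def_pblock.
by rewrite mem_pblock cov inE.
Qed.

(** Signs are drawn for all subsets of [T], not just for the blocks, so that the index type does not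
    depend on [P]. *)
Let block_sign (f : {ffun {set T} -> bool}) (v : T) : R := (-1) ^+ f (finset.pblock P v).

(** By orthogonality of the signs, an edge averages to 1 if its ends share a block and to 0
    otherwise. *)
Lemma avg_pair_sum :
  \sum_f pair_sum G (block_sign f)
  = #|{ffun {set T} -> bool}|%:R * \sum_(A in P) (nedges_in G A)%:R.
Proof.
rewrite /pair_sum exchange_big /=.
under [X in _ = _ * X]eq_bigr => A _.
  have -> : (nedges_in G A)%:R = \sum_(e in edges G) (e \subset A)%:R :> R.
    rewrite /nedges_in -sum1_card natr_sum big_mkcond [RHS]big_mkcond /=.
    by apply: eq_bigr => e _; rewrite inE; case: (e \in _); case: (_ \subset _).
  over.
rewrite [in RHS]exchange_big mulr_sumr; apply: eq_bigr => e eG.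
have := fintype.subsetP (edges_vpairs _ G) _ eG; rewrite inE => /cards2P[x [y [xy ->]]].
rewrite (eq_bigr (fun f => block_sign f x * block_sign f y)); last first.
  by move=> f _; rewrite prod_set2.
rewrite sum_signs; congr (_ * _).
case/and3P: (partP) => /eqP cov _ _.
have xP : finset.pblock P x \in P by rewrite pblock_mem // cov inE.
rewrite (bigD1 (finset.pblock P x)) //= big1 ?addr0 => [|A /andP[AP nA]].
  by rewrite finset.subUset !finset.sub1set !pblock_partition // eqxx eq_sym.
by rewrite finset.subUset !finset.sub1set !pblock_partition // eq_sym (negbTE nA).
Qed.

(** The degree sum is the signed sum of the block volumes; squaring it leaves only the diagonal
    terms on average. *)
Lemma avg_degree_sum :
  \sum_f degree_sum G (block_sign f) ^+ 2
  = #|{ffun {set T} -> bool}|%:R * \sum_(A in P) (vol G A)%:R ^+ 2.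
Proof.
have dE f : degree_sum G (block_sign f) = \sum_(A in P) (vol G A)%:R * (-1) ^+ f A.
  rewrite /degree_sum (eq_bigl [in [set: T]]) => [|v]; last by rewrite /= finset.in_setT.
  rewrite (set_partition_big _ partP) /=.
  apply: eq_bigr => A AP; rewrite /vol natr_sum mulr_suml; apply: eq_bigr => v.
  by rewrite pblock_partition // /block_sign => /eqP->.
under eq_bigr do rewrite dE expr2 big_distrlr /=.
rewrite exchange_big mulr_sumr; apply: eq_bigr => A AP /=.
rewrite exchange_big /= (bigD1 A) //= [X in _ + X]big1 ?addr0 => [|B /andP[_ nB]].
  under eq_bigr do rewrite mulrACA.
  by rewrite -mulr_sumr sum_signs eqxx mulr1 mulrC.
under eq_bigr do rewrite mulrACA.
by rewrite -mulr_sumr sum_signs eq_sym (negbTE nB) !mulr0.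
Qed.

(* A uniformly random sign for each block makes the right-hand sides average to
   the modularity. *)
Lemma modularity_le_signs (B : R) :
  (forall f : {ffun T -> bool},
     pair_sum G (fun v => (-1) ^+ f v) / (nedges G)%:R
     - (degree_sum G (fun v => (-1) ^+ f v) / (2 * nedges G)%N%:R) ^+ 2 <= B) ->
  modularity R G P <= B.
Proof.
move=> H.
have N0 : 0 < #|{ffun {set T} -> bool}|%:R :> R.
  by rewrite ltr0n; apply/card_gt0P; exists [ffun=> true].
rewrite -(ler_pM2l N0) /modularity.
have -> : #|{ffun {set T} -> bool}|%:R *
   \sum_(A in P) ((nedges_in G A)%:R / (nedges G)%:R -
                 ((vol G A)%:R / (2 * nedges G)%N%:R) ^+ 2)
  = \sum_f (pair_sum G (block_sign f) / (nedges G)%:R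
     - (degree_sum G (block_sign f) / (2 * nedges G)%N%:R) ^+ 2).
  under eq_bigr do rewrite expr_div_n.
  under [in RHS]eq_bigr do rewrite expr_div_n.
  by rewrite !sumrB mulrBr -!mulr_suml avg_pair_sum avg_degree_sum !mulrA.
have -> : #|{ffun {set T} -> bool}|%:R * B = \sum_(f : {ffun {set T} -> bool}) B.
  by rewrite sumr_const mulr_natl.
apply: ler_sum => f _.
have := H [ffun v => f (finset.pblock P v)].
congr (pair_sum G _ / _ - (degree_sum G _ / _) ^+ 2 <= B);
by apply: boolp.funext => v; rewrite ffunE.
Qed.

End Signs.

(** * Exponential moments and Chernoff's bound *)

Section Concentration.
Local Open Scope ring_scope.
Variable R : realType.

(** From exp(-x) >= 1 - x one gets exp(x) (1 - x) <= 1, while (1 - x)(1 + x + 2x^2) = 1 + x^2 (1 -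
    2x) >= 1. *)
Lemma expR_le_quadratic (x : R) : x <= 1 / 2 -> expR x <= 1 + x + 2 * x ^+ 2.
Proof.
move=> x2; have x1 : 0 < 1 - x by lra.
rewrite -(ler_pM2r x1); apply: (@le_trans _ _ 1); last first.
  have : 0 <= x ^+ 2 * (1 - 2 * x) by apply: mulr_ge0; [exact: sqr_ge0|lra].
  by rewrite -subr_ge0; congr (0 <= _); ring.
by rewrite -[leRHS](expRxMexpNx_1 x) ler_pM2l ?expR_gt0 // expR_ge1Dx.
Qed.

Variables (n : nat) (w : 'I_n -> R).
Hypothesis edge_prob01 : forall e, e \in vpairs 'I_n -> 0 <= edge_prob w e <= 1.
Implicit Types (G : sgraph 'I_n) (Q : pred (sgraph 'I_n)).

Lemma chung_lu_ge0 G : 0 <= chung_lu w G.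
Proof.
apply: prodr_ge0 => e /edge_prob01/andP[p0 p1].
by case: ifP => _; rewrite ?subr_ge0.
Qed.

Lemma chung_lu_sum1 : \sum_G chung_lu w G = 1.
Proof.
rewrite sum_sgraph_prod big1 // => e _.
by rewrite addrC subrK.
Qed.

Lemma chung_lu_prob_le1 Q : chung_lu_prob w Q <= 1.
Proof.
rewrite -chung_lu_sum1 [leRHS](bigID Q) /= lerDl.
by apply: sumr_ge0 => G _; apply: chung_lu_ge0.
Qed.

Lemma chung_lu_prob_union (I : finType) Q (bad : I -> pred (sgraph 'I_n)) :
  (forall G, (forall i, ~~ bad i G) -> Q G) ->
  1 - \sum_i chung_lu_prob w (bad i) <= chung_lu_prob w Q.
Proof.
move=> H; rewrite lerBlDr -chung_lu_sum1 (bigID Q) /= lerD2l.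
under [leRHS]eq_bigr do rewrite /chung_lu_prob big_mkcond /=.
rewrite exchange_big big_mkcond /=; apply: ler_sum => G _.
have S0 (A : pred I) : 0 <= \sum_(i | A i) (if bad i G then chung_lu w G else 0).
  by apply: sumr_ge0 => i _; case: ifP => // _; apply: chung_lu_ge0.
case: ifP => // nQ.
have /existsP[i bi] : [exists i, bad i G].
  by apply: contraNT nQ => /existsPn; apply: H.
by rewrite (bigD1 i) //= bi lerDl.
Qed.

(** By independence the exponential moment is a product of factors 1 + p (exp(lam c) - 1). Since lam
    c <= 1/2 and c^2 <= 4, each is at most exp(p (lam c + 8 lam^2)). *)
Lemma chung_lu_chernoff (c : {set 'I_n} -> R) (lam t : R) :
  (forall e, e \in vpairs 'I_n -> `|c e| <= 2) -> 0 <= lam <= 1 / 4 ->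
  chung_lu_prob w (fun G => \sum_(e in vpairs 'I_n) c e * edge_prob w e + t
                            < \sum_(e in edges G) c e)
  <= expR (8 * lam ^+ 2 * \sum_(e in vpairs 'I_n) edge_prob w e - lam * t).
Proof.
move=> c2 /andP[lam0 lam4].
set V := vpairs _; set p := edge_prob w; set m := \sum_(e in V) c e * p e.
pose g G := chung_lu w G * expR (lam * \sum_(e in edges G) c e).
have gE G : g G = \prod_(e in V)
    (if e \in edges G then p e * expR (lam * c e) else 1 - p e).
  rewrite /g mulr_sumr expR_sum.
  have -> : \prod_(e in edges G) expR (lam * c e)
          = \prod_(e in V) (if e \in edges G then expR (lam * c e) else 1).
    rewrite -big_mkcondr /=; apply: eq_bigl => e.
    by apply/idP/andP => [eG|[]//]; split=> //; apply: fintype.subsetP eG; apply: edges_vpairs.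
  by rewrite -big_split /=; apply: eq_bigr => e _; case: ifP => _; rewrite ?mulr1.
have gS : \sum_G g G <= expR (lam * m + 8 * lam ^+ 2 * \sum_(e in V) p e).
  under eq_bigr do rewrite gE.
  rewrite sum_sgraph_prod !mulr_sumr -big_split expR_sum /=.
  apply: ler_prod => e eV; have /andP[p0 p1] := edge_prob01 _ eV.
  have := c2 _ eV; rewrite ler_norml => /andP[cl cu].
  rewrite -/p in p0 p1; move: (p e) p0 p1 => q q0 q1.
  rewrite addr_ge0 ?mulr_ge0 ?expR_ge0 ?subr_ge0 //=.
  have lc : lam * c e <= 1 / 2 by nra.
  have cc : (lam * c e) ^+ 2 <= 4 * lam ^+ 2.
    have : c e ^+ 2 <= 4 by nra.
    have := sqr_ge0 lam; rewrite exprMn; nra.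
  apply: (le_trans _ (expR_ge1Dx _)).
  have /(ler_wpM2l q0) := expR_le_quadratic _ lc.
  have := ler_wpM2l q0 cc; lra.
(* Markov's inequality: on the event, the exponential weight is at least 1. *)
apply: (@le_trans _ _ (\sum_G g G * expR (- (lam * (m + t))))); last first.
  rewrite -mulr_suml; apply: (le_trans (ler_wpM2r (expR_ge0 _) gS)).
  by rewrite -expRD ler_expR; lra.
rewrite /chung_lu_prob big_mkcond /=; apply: ler_sum => G _.
rewrite /g -mulrA -expRD; case: ifP => [h|_].
  rewrite ler_peMr ?chung_lu_ge0 // -[leLHS]expR0 ler_expR.
  by rewrite -mulrBr mulr_ge0 // subr_ge0 ltW.
by rewrite mulr_ge0 ?chung_lu_ge0 ?expR_ge0.
Qed.

End Concentration.

(** * Sums behind the means of y and d *)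

Section Expectations.
Local Open Scope ring_scope.
Variables (R : realType) (T : finType).
Implicit Types (s w : T -> R).

Lemma sum_neq s (u : T) : \sum_(v | v != u) s v = (\sum_v s v) - s u.
Proof. by rewrite [in RHS](bigD1 u) //= addrC addrK. Qed.

Lemma sum_vpairs_prod w :
  2 * \sum_(e in vpairs T) \prod_(v in e) w v
  = (\sum_v w v) ^+ 2 - \sum_v w v ^+ 2.
Proof.
rewrite mulr_natl -sum_vpairs2 expr2 mulr_suml -sumrB; apply: eq_bigr => u _.
rewrite expr2 -mulrBr -sum_neq mulr_sumr; apply: eq_bigr => v vu.
by rewrite prod_set2 // eq_sym.
Qed.

(** Divided by the total weight W, this is the mean of d: the expected degree of v is w_v (W - w_v)
    / W. *)
Lemma sum_vpairs_sum_prod s w :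
  \sum_(e in vpairs T) (\sum_(v in e) s v) * (\prod_(v in e) w v)
  = \sum_v s v * w v * (\sum_u w u - w v).
Proof.
set X := RHS; set Y := LHS.
(* Over ordered pairs the two summands of s_u + s_v contribute equally, by symmetry. *)
suff : 2 * Y = X + X by lra.
rewrite mulr_natl -sum_vpairs2.
transitivity (\sum_u \sum_(v | v != u) (s u * w u * w v + s v * w v * w u)).
  apply: eq_bigr => u _; apply: eq_bigr => v; rewrite eq_sym => uv.
  by rewrite sum_set2 // prod_set2 //; ring.
under eq_bigr do rewrite big_split /=.
rewrite big_split /=; congr (_ + _); last rewrite (exchange_big_dep predT) //=.
  by apply: eq_bigr => u _; rewrite -mulr_sumr sum_neq.
apply: eq_bigr => u _; rewrite -mulr_sumr -sum_neq.
by congr (_ * _); apply: eq_bigl => v; rewrite eq_sym.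
Qed.

End Expectations.

(** * From concentration to a modularity bound *)

Section UpperTail.
Local Open Scope ring_scope.
Variable R : realType.

Lemma modularity_arith (y d m S W r : R) :
  0 < W -> 0 <= r <= 1 / 14 -> `|S| <= W ->
  2 * W * y <= S ^+ 2 + 12 * r * W ^+ 2 ->
  `|d - S| <= 7 * r * W -> `|2 * m - W| <= 7 * r * W ->
  y / m - (d / (2 * m)) ^+ 2 <= 168 * r.
Proof.
move=> W0 /andP[r0 r14] SW yle dS mW.
have rW : r * W <= 1 / 14 * W by rewrite ler_wpM2r // ltW.
have rW0 : 0 <= r * W by rewrite mulr_ge0 // ltW.
(* The bound r <= 1/14 makes the error 7rW at most W/2. *)
have /andP[mlo mhi] : W / 2 <= 2 * m <= W + 7 * (r * W).
  by move: mW; rewrite ler_norml => /andP[]; lra.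
have m0 : 0 < m by lra.
have -> : y / m - (d / (2 * m)) ^+ 2 = (4 * y * m - d ^+ 2) / (4 * m ^+ 2).
  by field; rewrite gt_eqF.
rewrite ler_pdivrMr; last by rewrite mulr_gt0 // exprn_gt0.
have S2 : S ^+ 2 <= W ^+ 2 by rewrite -real_normK ?num_real // lerXn2r ?nnegrE // ltW.
(* Expand d = S + (d - S) and drop the square of d - S. *)
have d2 : S ^+ 2 - 14 * r * W ^+ 2 <= d ^+ 2.
  have h : `|S * (d - S)| <= W * (7 * r * W) by rewrite normrM ler_pM.
  have := sqr_ge0 (d - S); move: h; rewrite ler_norml => /andP[+ _]; nra.
have K0 : 0 <= S ^+ 2 + 12 * r * W ^+ 2.
  by rewrite addr_ge0 ?sqr_ge0 // mulr_ge0 ?sqr_ge0 // mulr_ge0.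
have ym : 4 * y * m <= (S ^+ 2 + 12 * r * W ^+ 2) * (1 + 7 * r).
  rewrite -(ler_pM2l W0).
  apply: (@le_trans _ _ ((S ^+ 2 + 12 * r * W ^+ 2) * (2 * m))).
    have -> : W * (4 * y * m) = 2 * W * y * (2 * m) by ring.
    by rewrite ler_wpM2r //; lra.
  by apply: le_trans (ler_wpM2l K0 mhi) _; rewrite le_eqVlt; apply/orP; left; apply/eqP; ring.
(* The terms S^2 cancel, and the numerator is at most (7 + 12 + 6 + 14) r W^2 = 39 r W^2. As W^2 <=
   16 m^2, the quotient by 4 m^2 is at most 156 r. *)
have t1 : 7 * r * S ^+ 2 <= 7 * r * W ^+ 2 by rewrite ler_wpM2l // mulr_ge0.
have t2 : r * (r * W ^+ 2) <= 1 / 14 * (r * W ^+ 2).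
  by rewrite ler_wpM2r // mulr_ge0 ?sqr_ge0.
have t3 : r * (W ^+ 2 / 16) <= r * m ^+ 2.
  rewrite ler_wpM2l //; have -> : W ^+ 2 / 16 = (W / 4) ^+ 2 by field.
  by rewrite lerXn2r ?nnegrE; lra.
have t4 : 0 <= r * W ^+ 2 by rewrite mulr_ge0 ?sqr_ge0.
lra.
Qed.

Lemma normr_sum_set2_sign (T : finType) (e : {set T}) (f : T -> bool) :
  e \in vpairs T -> `|\sum_(v in e) (-1) ^+ f v : R| <= 2.
Proof.
rewrite inE => /cards2P[x [y [xy ->]]]; rewrite sum_set2 //.
by apply: le_trans (ler_normD _ _) _; rewrite !normr_sign.
Qed.

Lemma normr_prod_sign (T : finType) (e : {set T}) (f : T -> bool) :
  `|\prod_(v in e) (-1) ^+ f v : R| = 1.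
Proof. by rewrite normr_prod big1 // => v _; rewrite normr_sign. Qed.

(** * The probability bound for fixed n *)

Section Finite.
Variables (n : nat) (w : 'I_n -> R) (r : R).
Hypotheses (n0 : (0 < n)%N) (w0 : forall v, 0 < w v).
Let W := \sum_v w v.
Hypotheses (w2 : forall v, w v ^+ 2 <= W) (r01 : 0 < r <= 1 / 14)
  (rw : forall v, 1 <= r ^+ 2 * w v).

(** This makes the Chernoff exponent linear in n, enough to beat the number of sign vectors. *)
Let W_ge : n%:R <= r ^+ 2 * W.
Proof.
rewrite /W mulr_sumr -[n in n%:R]card_ord -sum1_card natr_sum.
exact: ler_sum.
Qed.

Let W0 : 0 < W.
Proof.
have r2 : 0 < r ^+ 2 by rewrite exprn_gt0 //; case/andP: r01.
by rewrite -(pmulr_rgt0 _ r2); apply: lt_le_trans W_ge; rewrite ltr0n.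
Qed.

Lemma edge_probE e : edge_prob w e = (\prod_(v in e) w v) / W.
Proof.
by rewrite /edge_prob /wmean mulrAC mulVf ?mul1r // pnatr_eq0 -lt0n.
Qed.

Lemma edge_prob_le1 e : e \in vpairs 'I_n -> 0 <= edge_prob w e <= 1.
Proof.
rewrite inE => /cards2P[x [y [xy ->]]]; rewrite edge_probE prod_set2 //.
have w00 v : 0 <= w v by rewrite ltW.
rewrite divr_ge0 ?mulr_ge0 ?(ltW W0) //= ler_pdivrMr // mul1r.
by have := w2 x; have := w2 y; have := sqr_ge0 (w x - w y); nra.
Qed.

Lemma sum_edge_prob_le : \sum_(e in vpairs 'I_n) edge_prob w e <= W / 2.
Proof.
under eq_bigr do rewrite edge_probE.
rewrite -mulr_suml ler_pdivrMr // -(@ler_pM2l _ 2) // sum_vpairs_prod -/W.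
have : 0 <= \sum_v w v ^+ 2 by apply: sumr_ge0 => v _; apply: sqr_ge0.
lra.
Qed.

(** As r^2 w_v >= 1, one has w_v <= r^2 w_v^2 <= r^2 W <= r W; multiply by w_v and sum. *)
Lemma sum_sqr_weight_le : \sum_v w v ^+ 2 <= r * W ^+ 2.
Proof.
have [r0 r1] := andP r01.
rewrite (expr2 W) mulrA mulr_sumr; apply: ler_sum => v _.
rewrite expr2 ler_wpM2r ?(ltW (w0 v)) //.
have h : w v <= r ^+ 2 * W.
  apply: (@le_trans _ _ (r ^+ 2 * w v ^+ 2)); last by rewrite ler_wpM2l ?sqr_ge0.
  by have := rw v; have := w0 v; nra.
apply: (le_trans h); rewrite ler_wpM2r ?(ltW W0) // expr2; nra.
Qed.

Lemma chernoff_weight (c : {set 'I_n} -> R) :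
  (forall e, e \in vpairs 'I_n -> `|c e| <= 2) ->
  chung_lu_prob w (fun G => \sum_(e in vpairs 'I_n) c e * edge_prob w e + 6 * r * W
                            < \sum_(e in edges G) c e)
  <= (1 / 4) ^+ n.
Proof.
have [r0 r1] := andP r01; move=> c2.
have r4 : 0 <= r <= 1 / 4 by apply/andP; split; lra.
(* With lam = r and t = 6rW the exponent is at most 4 r^2 W - 6 r^2 W = -2 r^2 W <= -2n. *)
apply: (le_trans (@chung_lu_chernoff _ _ _ edge_prob_le1 _ _ (6 * r * W) c2 r4)).
have e4 : 4 <= expR 2 :> R.
  have -> : 2 = 1 + 1 :> R by ring.
  by rewrite expRD; have := @expR_ge1Dx R 1; nra.
have -> : 1 / 4 = 4^-1 :> R by rewrite mul1r.
rewrite exprVn; apply: (@le_trans _ _ (expR (- (n%:R * 2)))).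
  rewrite ler_expR.
  have : r ^+ 2 * \sum_(e in vpairs 'I_n) edge_prob w e <= r ^+ 2 * (W / 2).
    by rewrite ler_wpM2l ?sqr_ge0 ?sum_edge_prob_le.
  have := W_ge; lra.
rewrite expRN expRM_natl lef_pV2 ?posrE ?exprn_gt0 ?expR_gt0 //.
by rewrite lerXn2r ?nnegrE ?expR_ge0.
Qed.

(** The left side is the square on the right minus its diagonal terms. *)
Lemma mean_pair_sum_le (f : 'I_n -> bool) :
  2 * W * (\sum_(e in vpairs 'I_n) (\prod_(v in e) (-1) ^+ f v) * edge_prob w e)
  <= (\sum_v (-1) ^+ f v * w v) ^+ 2.
Proof.
under eq_bigr do rewrite edge_probE mulrA -big_split /=.
have cancel X : 2 * W * (X / W) = 2 * X by field; rewrite gt_eqF.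
rewrite -mulr_suml cancel sum_vpairs_prod gerBl sumr_ge0 // => v _.
exact: sqr_ge0.
Qed.

(** The missing loops account for the difference, a signed sum of the terms w_v^2 / W. *)
Lemma mean_degree_sum_le (f : 'I_n -> bool) :
  `|\sum_(e in vpairs 'I_n) (\sum_(v in e) (-1) ^+ f v) * edge_prob w e
    - \sum_v (-1) ^+ f v * w v| <= r * W.
Proof.
under eq_bigr do rewrite edge_probE mulrA.
rewrite -mulr_suml sum_vpairs_sum_prod -/W mulr_suml -sumrB.
apply: le_trans (ler_norm_sum _ _ _) _.
apply: (@le_trans _ _ (\sum_v w v ^+ 2 / W)); last first.
  by rewrite -mulr_suml ler_pdivrMr // -mulrA -expr2 sum_sqr_weight_le.
apply: ler_sum => v _.
have -> : (-1) ^+ f v * w v * (W - w v) / W - (-1) ^+ f v * w v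
        = - ((-1) ^+ f v * (w v ^+ 2 / W)) by field; rewrite gt_eqF.
by rewrite normrN normrM normr_sign mul1r ger0_norm // divr_ge0 ?sqr_ge0 ?ltW.
Qed.

Lemma max_modularity_le (G : sgraph 'I_n) :
  (forall f : {ffun 'I_n -> bool},
    pair_sum R _ G (fun v => (-1) ^+ f v) <=
      \sum_(e in vpairs 'I_n) (\prod_(v in e) (-1) ^+ f v) * edge_prob w e
      + 6 * r * W) ->
  (forall f : {ffun 'I_n -> bool},
    degree_sum R _ G (fun v => (-1) ^+ f v) <=
      \sum_(e in vpairs 'I_n) (\sum_(v in e) (-1) ^+ f v) * edge_prob w e
      + 6 * r * W) ->
  max_modularity R G <= 168 * r.
Proof.
move=> Hpair Hdeg; have [r0 r1] := andP r01.
have S_le (f : 'I_n -> bool) : `|\sum_v (-1) ^+ f v * w v| <= W.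
  apply: le_trans (ler_norm_sum _ _ _) _; apply: ler_sum => v _.
  by rewrite normrM normr_sign mul1r ger0_norm // ltW.
have deg (f : {ffun 'I_n -> bool}) :
    `|degree_sum R _ G (fun v => (-1) ^+ f v) - \sum_v (-1) ^+ f v * w v|
    <= 7 * r * W.
  have up (g : {ffun 'I_n -> bool}) :
      degree_sum R _ G (fun v => (-1) ^+ g v) - \sum_v (-1) ^+ g v * w v <= 7 * r * W.
    have := Hdeg g; have := mean_degree_sum_le g.
    rewrite ler_norml => /andP[_]; lra.
  rewrite ler_norml up andbT lerNl.
  (* Negating all signs turns the upper bound into the lower one. *)
  have := up [ffun v => ~~ f v].
  have -> : degree_sum R _ G (fun v => (-1) ^+ [ffun v => ~~ f v] v)
     = - degree_sum R _ G (fun v => (-1) ^+ f v).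
    by rewrite -sumrN; apply: eq_bigr => v _; rewrite ffunE signrN mulrN.
  have -> : \sum_v (-1) ^+ [ffun v => ~~ f v] v * w v = - \sum_v (-1) ^+ f v * w v.
    by rewrite -sumrN; apply: eq_bigr => v _; rewrite ffunE signrN mulNr.
  lra.
(* With all signs +1, d is 2m and S is W, so the edge count is controlled by the same hypothesis. *)
have mE : degree_sum R _ G (fun v => (-1) ^+ [ffun=> false] v) = 2 * (nedges G)%:R.
  rewrite degree_sumE /nedges -sum1_card natr_sum mulr_sumr; apply: eq_bigr => e eG.
  have := fintype.subsetP (edges_vpairs _ G) _ eG.
  rewrite inE => /cards2P[x [y [xy ->]]]; rewrite sum_set2 // !ffunE.
  by ring.
have SE : \sum_v (-1) ^+ [ffun=> false] v * w v = W.
  by apply: eq_bigr => v _; rewrite ffunE mul1r.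
have mW := deg [ffun=> false]; rewrite mE SE in mW.
have part P : finset.partition P [set: 'I_n] -> modularity R G P <= 168 * r.
  move=> partP; apply: modularity_le_signs => // f.
  rewrite natrM.
  apply: (@modularity_arith _ _ _ (\sum_v (-1) ^+ f v * w v) W) => //.
    by rewrite r1 ltW.
  have := Hpair f; have := mean_pair_sum_le f.
  by move=> h1; rewrite -(@ler_pM2l _ (2 * W)) ?mulr_gt0 //; lra.
(* The default of the maximum also needs the bound; its single block is nonempty because n > 0. *)
apply: bigmax_le => //; apply: part.
apply/and3P; split.
- by rewrite finset.cover1.
- by apply: finset.trivIset1.
- rewrite inE eq_sym; apply/finset.set0Pn; exists (Ordinal n0).
  by rewrite inE.
Qed.

Lemma chung_lu_max_modularity :
  1 - 2 * (1 / 2) ^+ n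
  <= chung_lu_prob w (fun G => max_modularity R G <= 168 * r).
Proof.
(* The boolean selects y or d, so there are 2 * 2^n bad events, each of probability at most
   4^(-n). *)
pose c (i : {ffun 'I_n -> bool} * bool) (e : {set 'I_n}) : R :=
  if i.2 then \prod_(v in e) (-1) ^+ i.1 v else \sum_(v in e) (-1) ^+ i.1 v.
pose bad i (G : sgraph 'I_n) :=
  \sum_(e in vpairs 'I_n) c i e * edge_prob w e + 6 * r * W
  < \sum_(e in edges G) c i e.
have c2 i e : e \in vpairs 'I_n -> `|c i e| <= 2.
  rewrite /c; case: i.2 => eV; last exact: normr_sum_set2_sign.
  by rewrite normr_prod_sign ler1n.
apply: (@le_trans _ _ (1 - \sum_i chung_lu_prob w (bad i))); last first.
  apply: (@chung_lu_prob_union _ _ _ edge_prob_le1) => G nbad.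
  apply: max_modularity_le => f.
    by have := nbad (f, true); rewrite -leNgt.
  by have := nbad (f, false); rewrite -leNgt degree_sumE.
rewrite lerD2l lerN2.
apply: (@le_trans _ _ (\sum_(i : {ffun 'I_n -> bool} * bool) (1 / 4) ^+ n)).
  by apply: ler_sum => i _; apply: chernoff_weight; apply: c2.
rewrite sumr_const card_prod card_ffun card_bool card_ord -[leLHS]mulr_natl.
rewrite natrM natrX mulrAC -exprMn mulrC.
by have -> : 2 * (1 / 4) = 1 / 2 :> R by field.
Qed.

End Finite.
End UpperTail.

(** * Passage to the limit *)

Local Open Scope classical_set_scope.
Local Open Scope ring_scope.

Theorem corollary5p3 (R : realType) :
  exists c0 w0 : R, [/\ 0 < c0, 0 < w0 &
    forall w : forall n : nat, 'I_n -> R,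
      (forall (n : nat) (v : 'I_n), 0 < w n v) ->
      (fun n : nat => \big[Num.max/0]_v (w n v ^+ 2))
        =o_\oo (fun n : nat => wmean (w n) * n%:R) ->
      (\forall n \near \oo,
        w0 <= wmin (w n) <= wmax (w n) /\ wmax (w n) <= n%:R `^ (99 / 100)) ->
      chung_lu_prob (w n)
        (fun G => max_modularity R G <= c0 * wmin (w n) `^ (- (1 / 2)))
        @[n --> \oo] --> (1 : R)].
Proof.
(* 168 is the factor in [modularity_arith]; 196 = 14^2 ensures r <= 1/14. *)
exists 168, 196; split => // w w_gt0 /eqoP ow hw.
have w2 : \forall n \near \oo, forall v : 'I_n, w n v ^+ 2 <= \sum_u w n u.
  (* The little-o assumption enters with constant 1; it gives edge probabilities at most 1 for large
     n. *)
  have := ow 1 ltr01; apply: filterS => n + v.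
  have n0 : (0 < n)%N by case: n v => // -[].
  rewrite mul1r /wmean mulrAC mulVf ?pnatr_eq0 -?lt0n // mul1r => H.
  rewrite -[leRHS]ger0_norm; last by apply: sumr_ge0 => u _; apply: ltW.
  apply: le_trans H; apply: le_trans (ler_norm _).
  exact: (@le_bigmax _ _ _ 0 (fun u => w n u ^+ 2) v).
have lim1 : (1 - 2 * (1 / 2) ^+ n) @[n --> \oo] --> (1 : R).
  rewrite -[X in _ --> X]subr0; apply: cvgB; first exact: cvg_cst.
  by apply: (@cvg_geometric R 2 (1 / 2)); rewrite ger0_norm; lra.
apply: (squeeze_cvgr _ lim1); last exact: cvg_cst.
near=> n.
have n0 : (0 < n)%N by near: n; exists 1%N.
have w2n : forall v : 'I_n, w n v ^+ 2 <= \sum_u w n u by near: n.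
have [/andP[wm _] _] : 196 <= wmin (w n) <= wmax (w n) /\ wmax (w n) <= n%:R `^ (99 / 100).
  by near: n.
set r := wmin (w n) `^ (- (1 / 2)).
have r0 : 0 < r by apply: powR_gt0; lra.
have rm : r ^+ 2 * wmin (w n) = 1.
  have wm0 : 0 < wmin (w n) by lra.
  by rewrite /r powRN mul1r powR12_sqrt ?ltW // exprVn sqr_sqrtr ?ltW // mulVf // gt_eqF.
have r01 : 0 < r <= 1 / 14.
  rewrite r0 /= leNgt; apply/negP => r14.
  have : (1 / 14) ^+ 2 < r ^+ 2 by rewrite ltrXn2r.
  nra.
have rw v : 1 <= r ^+ 2 * w n v.
  by rewrite -rm ler_wpM2l ?sqr_ge0 // bigmin_le.
apply/andP; split; first exact: chung_lu_max_modularity.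
by apply: chung_lu_prob_le1; apply: (@edge_prob_le1 _ _ _ r).
Unshelve. all: by end_near.
Qed.
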